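(* For all integers $r\ge 0$, $z\ge 1$ and $k\ge 1$, $N(r,z,k)\le N(r,z+1,k)$. If $r=0$, then strict inequality holds.
   Context: A (finite) mixed graph $G$ consists of a vertex set $V(G)$, a set of undirected edges and a set of directed arcs (ordered pairs of vertices). Loops are forbidden, as are parallel edges and arcs. Write $u\sim v$ if there is an edge between $u$ and $v$, and $u\to v$ if there is an arc from $u$ to $v$. The undirected degree of $u$ is the number of edges incident with $u$; the directed out-degree of $u$ is the number of arcs with initial vertex $u$. A walk of length $\ell$ from $u_0$ to $u_\ell$ is a sequence $u_0u_1\dots u_\ell$ of vertices such that for each $0\le i\le \ell-1$ either $u_i\sim u_{i+1}$ or $u_i\to u_{i+1}$. A mixed path is a non-backtracking walk, i.e. a walk that never traverses an edge and then immediately retraces it (no $u_i\sim u_{i+1}\sim u_i$); walks of length $0$ are allowed. $G$ is $k$-geodetic if for every ordered pair $(u,v)$ of (not necessarily distinct) vertices there is at most one mixed path from $u$ to $v$ of length $\le k$. $N(r,z,k)$ denotes the smallest possible order of a $k$-geodetic mixed graph with minimum undirected degree $r$ and minimum directed out-degree $z$ (such graphs exist for all $r\ge 0$, $z,k\ge 1$). The case $r=0$ is that of purely directed graphs. *)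

(* Defs.v *)
From mathcomp Require Import all_boot.
From Stdlib Require Import ClassicalEpsilon.

Set Implicit Arguments.
Unset Strict Implicit.
Unset Printing Implicit Defensive.

(* [edge_arcN] forbids an arc parallel to an edge; with [edge_sym] it covers
   both orientations of the arc.  A pair of opposite arcs u -> v, v -> u is not
   parallel and is allowed, as usual for digraphs.  Parallel edges (resp. arcs)
   are excluded because edges and arcs are relations. *)
Record mixedGraph := MixedGraph {
  vertex :> finType;
  edge : rel vertex;
  arc : rel vertex;
  edge_sym : symmetric edge;
  edge_irr : irreflexive edge;
  arc_irr : irreflexive arc;
  edge_arcN : forall u v, ~~ (edge u v && arc u v)
}.

Section MixedGraph.
Variable G : mixedGraph.
Implicit Types (u v : G) (p q : seq G).

Definition undeg u := #|[set v | edge u v]|.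
Definition outdeg u := #|[set v | arc u v]|.

Definition step : rel G := fun u v => edge u v || arc u v.

(* As an edge and an arc never join the same two vertices, the steps
   u_i u_(i+1) and u_(i+1) u_(i+2) = u_i traverse the same edge
   exactly when u_i ~ u_(i+1) ~ u_i. *)
Definition nonbacktracking u p :=
  let s := nth u (u :: p) in
  forall i, i.+1 < size p ->
    ~ [/\ edge (s i) (s i.+1), edge (s i.+1) (s i.+2) & s i.+2 = s i].

(* The mixed path u_0 u_1 ... u_l is given by u = u_0 and p = [u_1; ...; u_l],
   so its length is [size p]. *)
Definition mixed_path u v p :=
  [/\ path step u p, last u p = v & nonbacktracking u p].

Definition k_geodetic k :=
  forall u v p q, mixed_path u v p -> mixed_path u v q ->
    size p <= k -> size q <= k -> p = q.

Definition has_min (f : G -> nat) d :=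
  (exists u, f u = d) /\ (forall u, d <= f u).

End MixedGraph.

Definition order_attained (r z k n : nat) : Prop :=
  exists G : mixedGraph,
    [/\ #|G| = n, k_geodetic G k, has_min (@undeg G) r & has_min (@outdeg G) z].

(* The value is unspecified when no such graph exists, which never happens
   for z, k >= 1. *)
Definition N (r z k : nat) : nat :=
  epsilon (inhabits 0) (fun n =>
    order_attained r z k n /\ forall m, order_attained r z k m -> n <= m).

(* Main.v *)
Require Import Defs.
From mathcomp Require Import all_boot.
From mathcomp Require Import fingroup perm.
From Stdlib Require Import ClassicalEpsilon.
(* Otherwise [arc] would be the arc of a cyclic sequence. *)
Import Defs.

(** Being k-geodetic passes to subgraphs, so both inequalities come from making
    an optimal graph [G] for out-degree [z.+1] smaller.

    For the weak inequality, discard arcs of [G] until every vertex has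
    out-degree exactly [z]; the vertices and the edges are untouched.  For the
    strict one, where the minimum undirected degree is 0, discard all the edges
    of [G] and one vertex: each other vertex loses at most one out-arc, hence
    still has out-degree at least [z], and the surplus arcs can again be
    discarded.  The order has dropped by one.

    As the minimum [N r z k] has a meaning only if some graph attains the given
    degrees, it remains to construct one, [cgraph].  It imitates the regular
    tree whose edges are properly coloured by a finite set: a non-backtracking
    walk of the tree is a word without two equal consecutive letters (a reduced
    word), and two different reduced words lead to different places.  To make
    this finite but keep it true for words of length at most [k], each colour
    acts by a permutation of the words of bounded length, by adding or removing
    that colour as first letter.  These permutations are involutions, and
    composing them along a short reduced word sends the empty word to that word
    itself; hence in the (bipartite double of the) Cayley graph they generate,
    short reduced words from a fixed vertex have distinct end points
    ([foldl_next_inj]).  Some of the colours are used for edges; each of the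
    others is used for arcs, all going from one side of the bipartition to the
    other, so that no arc can be followed by a step of its own colour.  Thus
    mixed paths are reduced words ([mixed_path_word]), and the graph is
    k-geodetic. *)

(** * Subgraphs *)

(** Steps cannot change their nature under an embedding: an arc of [H] becomes
    an arc of [G], which is not parallel to an edge.  Hence an edge of [G]
    traversed back and forth by the image of a mixed path comes from an edge of
    [H], and mixed paths of [H] are mapped to mixed paths of [G]. *)

Lemma k_geodetic_embedding (H G : mixedGraph) (f : H -> G) k :
    injective f -> {homo f : x y / edge x y} -> {homo f : x y / arc x y} ->
  k_geodetic G k -> k_geodetic H k.
Proof.
move=> f_inj f_edge f_arc geoG.
have edge_reflect (x y : H) : step x y -> edge (f x) (f y) -> edge x y.
  case/orP=> // /f_arc axy exy.
  by move: (edge_arcN (f x) (f y)); rewrite exy axy.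
have f_path (u v : H) p : mixed_path u v p -> mixed_path (f u) (f v) (map f p).
  case=> p_path <- p_nb; split; last 1 first.
  - move=> i; rewrite size_map => i_lt.
    have nth_f j : j <= size p ->
        nth (f u) (f u :: map f p) j = f (nth u (u :: p) j).
      by move=> j_le; rewrite -map_cons (nth_map u).
    rewrite !nth_f ?(ltnW i_lt) ?(ltnW (ltnW i_lt)) //.
    move=> [e1 e2 /f_inj back]; apply: (p_nb i i_lt); split=> //.
      by apply: edge_reflect e1; apply: (pathP u p_path); apply: ltnW.
    by apply: edge_reflect e2; apply: (pathP u p_path).
  - rewrite path_map; apply: sub_path p_path => x y /orP[/f_edge|/f_arc] xy.
      by rewrite /relpre /= /step xy.
    by rewrite /relpre /= /step xy orbT.
  - by rewrite last_map.
move=> u v p q /f_path up /f_path uq p_le q_le; apply: (inj_map f_inj).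
by apply: geoG up uq _ _; rewrite size_map.
Qed.

Lemma subset_of_card (T : finType) (A : {set T}) d :
  d <= #|A| -> {B : {set T} | B \subset A & #|B| = d}.
Proof.
move=> dA; exists [set x in take d (enum A)].
  by apply/subsetP=> x; rewrite inE => /mem_take; rewrite mem_enum.
rewrite cardsE (card_uniqP _) ?take_uniq ?enum_uniq // size_takel //.
by rewrite -cardE.
Qed.

Lemma order_attained_trim (G : mixedGraph) r z k :
    k_geodetic G k -> has_min (@undeg G) r -> (forall u : G, z <= outdeg u) ->
  order_attained r z k #|G|.
Proof.
move=> geoG [[u0 u0r] ler] lez.
pose out (u : G) : {set G} := s2val (subset_of_card _ _ _ (lez u)).
have outS (u : G) : out u \subset [set v | arc u v] :=
  s2valP (subset_of_card _ _ _ (lez u)).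
have card_out (u : G) : #|out u| = z := s2valP' (subset_of_card _ _ _ (lez u)).
have out_arc (u v : G) : v \in out u -> arc u v.
  by move/(subsetP (outS u)); rewrite inE.
have irr : irreflexive (fun u v : G => v \in out u).
  by move=> u; apply/negP=> /out_arc; rewrite arc_irr.
have eaN (u v : G) : ~~ (edge u v && (v \in out u)).
  by apply/negP=> /andP[e /out_arc a]; move: (edge_arcN u v); rewrite e a.
pose H := MixedGraph (@edge_sym G) (@edge_irr G) irr eaN.
have outH (u : H) : outdeg u = z by rewrite -(card_out u); apply: eq_card => v; rewrite inE.
exists H; split=> //.
- apply: (k_geodetic_embedding H G id) => // u v /out_arc.
- by split; [exists u0 | ].
- by split=> [|u]; [exists u0 | rewrite outH].
Qed.

(** In the absence of parallel arcs, deleting [v] removes at most one out-arc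
    from each other vertex; the edges are dropped to have undirected degree 0
    everywhere, since [v] might be the only vertex of undirected degree 0. *)
Lemma order_attained_delete (G : mixedGraph) z k (v : G) :
    k_geodetic G k -> (forall u : G, z < outdeg u) ->
  order_attained 0 z k #|G|.-1.
Proof.
move=> geoG ltz.
pose T : finType := {x : G | x != v}.
pose a : rel T := fun x y => arc (val x) (val y).
have a_irr : irreflexive a by move=> x; apply: arc_irr.
have e_sym : symmetric (fun _ _ : T => false) by [].
have e_irr : irreflexive (fun _ _ : T => false) by [].
pose H := @MixedGraph T (fun _ _ => false) a e_sym e_irr a_irr (fun _ _ => isT).
have cardH : #|H| = #|G|.-1 by rewrite card_sig cardC1.
have undegH (x : H) : undeg x = 0.
  by apply/eqP; rewrite cards_eq0; apply/eqP/setP=> y; rewrite !inE.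
have outH (x : H) : z <= outdeg x.
  rewrite -ltnS; apply: leq_trans (ltz (val x)) _.
  rewrite /outdeg (cardsD1 v) -(add1n #|_|).
  rewrite leq_add ?leq_b1 // -(card_imset _ val_inj) subset_leq_card //.
  apply/subsetP=> y; rewrite !inE => /andP[yv xy].
  by apply/imsetP; exists (Sub y yv); rewrite ?inE.
rewrite -cardH; apply: order_attained_trim => //.
  apply: (k_geodetic_embedding H G val) => //; apply: val_inj.
(* An out-neighbour of [v] witnesses that a vertex is left. *)
have /card_gt0P[w] : 0 < outdeg v by apply: leq_trans (ltz v).
rewrite inE => vw.
have wv : w != v by apply: contraTneq vw => ->; rewrite arc_irr.
by split=> [|x]; [exists (Sub w wv) | ].
Qed.

(** * Words acted on by their letters *)

Section Flip.
Variables (C : finType) (L : nat).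
Implicit Types (c : C) (w : seq C).

(** Left multiplication by the generator [c] in the free product of groups of
    order 2 indexed by [C], truncated to length [L].  Both a reduced word that
    is too long to be extended and a word starting with [c] twice are fixed;
    the second case makes the map an involution on all the words, reduced or
    not, and so avoids a subtype of reduced words. *)
Definition flip_seq c w :=
  if ohead w == Some c then
    if ohead (behead w) == Some c then w else behead w
  else if size w < L then c :: w else w.

Lemma size_flip_seq c (w : L.-bseq C) : size (flip_seq c w) <= L.
Proof.
rewrite /flip_seq; have := size_bseq w; case: (val w) => [|d s] /= sL.
  by case: ifP.
by do 2!case: ifP => //= _; apply: ltnW.
Qed.

Definition flip c (w : L.-bseq C) : L.-bseq C := Bseq (size_flip_seq c w).

Lemma flipK c : involutive (flip c).
Proof.
move=> w; apply: val_inj; rewrite /= /flip_seq.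
have := size_bseq w; case: (val w) => [|d s] /= sL.
  by case: (ltnP 0 L) => L0 /=; rewrite ?eqxx //= ltnNge L0.
have [[dc]|dc] := eqVneq (Some d) (Some c).
  have [sc|sc] := eqVneq (ohead s) (Some c); first by rewrite /= dc sc !eqxx.
  by rewrite (negPf sc) sL dc.
by case: ltnP => dL /=; rewrite ?eqxx (negPf dc) // ltnNge dL.
Qed.

Definition flip_perm c : {perm L.-bseq C} := perm (inv_inj (flipK c)).

(** The neighbours of a vertex in the bipartite double of the Cayley graph of
    the permutations [flip_perm c]; the boolean is the side.  The new factor
    comes on the left, so that it acts before the previous ones: following a
    word from left to right then lets its letters act from right to left, and
    the empty word grows into that word and not into its reversal. *)
Definition next (x : {perm L.-bseq C} * bool) c := (flip_perm c * x.1, ~~ x.2)%g.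

Lemma nextK c : involutive (next^~ c).
Proof.
case=> s b; rewrite /next /= negbK mulgA; congr (_, _).
by apply/permP=> w; rewrite !permM !permE flipK.
Qed.

Lemma foldl_nextE x w u : (foldl next x w).1 u = x.1 (foldr flip u w).
Proof. by elim: w x => //= c w IHw x; rewrite IHw permM permE. Qed.

Definition reduced w := sorted (fun c d => c != d) w.

Lemma foldr_flip_nil w :
  reduced w -> size w <= L -> foldr flip [bseq] w = w :> seq C.
Proof.
rewrite /reduced; elim: w => //= c w IHw cw_red wL.
rewrite /flip_seq IHw ?(path_sorted cw_red) ?(ltnW wL) //.
case: w cw_red wL {IHw} => [|d w] /= => [_ L0|/andP[cd _] wL]; first by rewrite L0.
have -> : (Some d == Some c) = false by apply: contraNF cd => /eqP[->].
by rewrite wL.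
Qed.

(** The permutation reached from [x] by [w] sends the empty word to the image
    of [w] by the permutation [x.1], which determines [w]. *)
Lemma foldl_next_inj x w1 w2 :
    reduced w1 -> reduced w2 -> size w1 <= L -> size w2 <= L ->
  foldl next x w1 = foldl next x w2 -> w1 = w2.
Proof.
move=> red1 red2 L1 L2 eqx.
rewrite -(foldr_flip_nil w1) // -(foldr_flip_nil w2) //; congr val.
by apply: (@perm_inj _ x.1); rewrite -!foldl_nextE eqx.
Qed.

Lemma last_scanl_next x w : last x (scanl next x w) = foldl next x w.
Proof. by elim: w x => //= c w IHw x. Qed.

End Flip.

Arguments reduced {C} w.

(** * A geodetic graph with given degrees *)

Section Construction.
Variables r z k : nat.

(** [inl i] is a colour of edges, and [inr (j, b)] a colour of arcs that leave
    the side [b].  Only the arcs leaving the side of a vertex count for its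
    out-degree, which is therefore [z] and not twice [z]. *)
Definition color : finType := ('I_r + 'I_z * bool)%type.

(** Words of length 1 must be distinguished even if [k] is 0, in order that
    colours give distinct neighbours: hence the bound [k.+1]. *)
Definition cvertex : finType := ({perm k.+1.-bseq color} * bool)%type.
Implicit Types (x y : cvertex) (c : color) (w : seq color).

Local Notation next := (@next color k.+1).

Lemma next_inj x : injective (next x).
Proof.
move=> c d cd.
by case: (@foldl_next_inj color k.+1 x [:: c] [:: d] isT isT isT isT cd).
Qed.

Definition cedge : rel cvertex :=
  fun x y => [exists i, y == next x (inl i)].
Definition carc : rel cvertex :=
  fun x y => [exists j, y == next x (inr (j, x.2))].

Lemma next_neq x c : (x == next x c) = false.
Proof. by apply/eqP=> /(congr1 snd) /=; case: x.2. Qed.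

Lemma cedge_sym : symmetric cedge.
Proof.
by move=> x y; apply/existsP/existsP=> -[i /eqP ->]; exists i; rewrite nextK.
Qed.

Lemma cedge_irr : irreflexive cedge.
Proof. by move=> x; apply/existsP=> -[i]; rewrite next_neq. Qed.

Lemma carc_irr : irreflexive carc.
Proof. by move=> x; apply/existsP=> -[j]; rewrite next_neq. Qed.

Lemma cedge_carcN x y : ~~ (cedge x y && carc x y).
Proof.
by apply/negP=> /andP[/existsP[i /eqP->] /existsP[j /eqP/next_inj]].
Qed.

Definition cgraph := MixedGraph cedge_sym cedge_irr carc_irr cedge_carcN.

Lemma undeg_cgraph (x : cgraph) : undeg x = r.
Proof.
rewrite -[RHS]card_ord -cardsT -(@card_imset _ _ (fun i => next x (inl i))).
  apply: eq_card => y; rewrite inE.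
  by apply/existsP/imsetP=> [[i /eqP->]|[i _ ->]]; exists i; rewrite ?inE.
by move=> i j /next_inj [].
Qed.

Lemma outdeg_cgraph (x : cgraph) : outdeg x = z.
Proof.
rewrite -[RHS]card_ord -cardsT.
rewrite -(@card_imset _ _ (fun j => next x (inr (j, x.2)))).
  apply: eq_card => y; rewrite inE.
  by apply/existsP/imsetP=> [[i /eqP->]|[i _ ->]]; exists i; rewrite ?inE.
by move=> i j /next_inj [].
Qed.

Definition legal x c := if c is inr (_, b) then b == x.2 else true.

Lemma legal_step x y :
  step (x : cgraph) y -> exists2 c, legal x c & y = next x c.
Proof.
case/orP=> /existsP[i /eqP ->]; first by exists (inl i).
by exists (inr (i, x.2)) => //=.
Qed.

(** Two consecutive steps of the same colour come back to the starting point.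
    The colour is not one of arcs, as it would have to leave both sides; so
    both steps traverse the same edge, which a mixed path does not do.  The
    last clause is what the induction needs to know about the next step. *)
Lemma mixed_path_word (x y : cgraph) p : mixed_path x y p ->
  exists w, [/\ p = scanl next x w, reduced w
              & forall c, ohead w = Some c -> legal x c].
Proof.
elim: p x => [|x1 p IHp] x; first by exists [::].
case=> /= /andP[/legal_step[c legc def_x1] p_path] p_last p_nb.
have p1_nb : nonbacktracking (x1 : cgraph) p.
  move=> i i_lt; have := p_nb i.+1 i_lt.
  by rewrite /= !(set_nth_default (x1 : cgraph) x) //= ltnW // ltnW.
have [|w [def_p w_red legw]] := IHp x1; first by split.
exists (c :: w); split; last by move=> _ [<-].
  by rewrite /= -def_x1 -def_p.
case: w def_p w_red legw => //= d w def_p w_red legw.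
rewrite w_red andbT; apply/eqP=> cd; subst d.
have {legw} := legw c (erefl _); rewrite def_x1 => legc1.
apply: (p_nb 0); rewrite def_p //= def_x1 nextK.
case: c legc legc1 {def_p w_red def_x1} => [i|[j b]] /=; last first.
  by move=> /eqP->; case: x.2.
by split=> //; apply/existsP; exists i; rewrite ?nextK.
Qed.

Lemma k_geodetic_cgraph : k_geodetic cgraph k.
Proof.
move=> x y p q xp xq.
have [[_ lastp _] [_ lastq _]] := (xp, xq).
have [wp [def_p redp _]] := mixed_path_word _ _ _ xp.
have [wq [def_q redq _]] := mixed_path_word _ _ _ xq.
rewrite {}def_p {}def_q !size_scanl in lastp lastq * => kp kq.
congr scanl; apply: (@foldl_next_inj _ k.+1 x) => //; try exact: leqW.
by rewrite -!last_scanl_next lastp.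
Qed.

Lemma order_attained_cgraph : order_attained r z k #|cgraph|.
Proof.
pose x0 : cgraph := (1%g, true).
exists cgraph; split=> //; first exact: k_geodetic_cgraph.
  by split=> [|x]; [exists x0|]; rewrite undeg_cgraph.
by split=> [|x]; [exists x0|]; rewrite outdeg_cgraph.
Qed.

End Construction.

(** * Monotonicity *)

Lemma N_spec r z k : order_attained r z k (N r z k) /\
  forall m, order_attained r z k m -> N r z k <= m.
Proof.
apply: (epsilon_spec (inhabits 0) (fun n => order_attained r z k n /\
  forall m, order_attained r z k m -> n <= m)).
pose P n : bool := excluded_middle_informative (order_attained r z k n).
have PP n : reflect (order_attained r z k n) (P n) by apply: sumboolP.
have exP : exists n, P n.
  by exists #|cgraph r z k|; apply/PP/order_attained_cgraph.
by case: (ex_minnP exP) => n /PP nP n_min; exists n; split=> // m /PP /n_min.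
Qed.

Theorem theorem10 (r z k : nat) (hz : 1 <= z) (hk : 1 <= k) :
  N r z k <= N r z.+1 k /\ (r = 0 -> N r z k < N r z.+1 k).
Proof.
have [_ N_min] := N_spec r z k.
have [[G [<- geoG minr [[v _] minz]]] _] := N_spec r z.+1 k.
split=> [|r0]; first by apply/N_min/order_attained_trim=> // u; apply: ltnW.
have G_gt0 : 0 < #|G| by apply/card_gt0P; exists v.
rewrite -(prednK G_gt0) ltnS; apply: N_min.
by rewrite r0; apply: order_attained_delete v geoG minz.
Qed.
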